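(* Let $q\in(0,1)$. Assume that the partitions $\lambda\in\Lambda_n$, $\nu\in\Lambda_{n-1}$ are such that there exist $d$ indices, for some $1\le d\le l(\lambda^\top)$, $1\le s_1<\dots<s_d\le n$ satisfying $s_{i+1}>s_i+1$, such that for $1\le i\le d$ $$\min\{\nu_{s_i-1},\lambda_{s_i}\}-\max\{\nu_{s_i},\lambda_{s_i+1}\}=1$$ and $$\max\{\nu_j,\lambda_{j+1}\}=\min\{\nu_{j-1},\lambda_j\}\quad\text{for }j\ne s_1,\dots,s_d,\ 1\le j\le n.$$ Then $P_{\lambda\setminus\nu}(x;q,t_0)$ does not depend on $t_0$ and $Q^{(n-1,n)}_{x,q}(\nu,\lambda)=P_{\lambda\setminus\nu}(x;q,t_0)$.
   Context: **Partitions.** $\Lambda_n=\{\lambda\in\mathbb Z^n:\lambda_1\ge\dots\ge\lambda_n\ge0\}$, $|\lambda|=\sum_i\lambda_i$, $\lambda^\top_i=|\{j:\lambda_j\ge i\}|$ (transpose), $l(\lambda^\top)=\lambda_1$ is the number of non-zero parts of $\lambda^\top$, $\nu\preceq\mu$ iff $\mu_1\ge\nu_1\ge\mu_2\ge\nu_2\ge\cdots$. Conventions: $\nu_0=+\infty$, $\nu_n=0$ for $\nu\in\Lambda_{n-1}$, $\lambda_{n+1}=0$ for $\lambda\in\Lambda_n$. $\binom mk_q=\frac{(q;q)_m}{(q;q)_k(q;q)_{m-k}}$, $(x;q)_m=\prod_{k=0}^{m-1}(1-xq^k)$. **The polynomial $Q$.** $$Q^{(n-1,n)}_{x,q}(\nu,\lambda)=\sum_{\mu\in\Lambda_n:\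 \nu\preceq\mu\preceq\lambda}x^{2|\mu|-|\nu|-|\lambda|}\prod_{i=1}^{n-1}\binom{\lambda_i-\lambda_{i+1}}{\lambda_i-\mu_i}_q\binom{\mu_i-\mu_{i+1}}{\mu_i-\nu_i}_q\binom{\lambda_n}{\lambda_n-\mu_n}_q.$$ **The branching polynomial $P_{\lambda\setminus\nu}(x;q,t_0)$** (of the deformed hyperoctahedral $q$-Whittaker functions with parameters $(t_0,0,0,0)$, $0<|t_0|<1$). For $\lambda\in\Lambda_n,\nu\in\Lambda_{n-1}$ with $\lambda^\top_i-\nu^\top_i\in\{0,1,2\}$ for all $1\le i\le m:=l(\lambda^\top)$, let $d=d(\lambda,\nu)=|\{1\le i\le m:\lambda^\top_i-\nu^\top_i=1\}|$ and $$P_{\lambda\setminus\nu}(x;q,t_0)=\sum_{r=0}^dB^r_{\lambda\setminus\nu}(q,t_0)\langle x;t_0\rangle_{q,r},\qquad \langle x;t_0\rangle_{q,0}=1,\quad \langle x;t_0\rangle_{q,r}=\prod_{l=1}^r(x+x^{-1}-t_0q^{l-1}-t_0^{-1}q^{-(l-1)}),$$ $$B^r_{\lambda\setminus\nu}(q,t_0)=c(\lambda,\nu;q)\sum_{\substack{I_+,I_-\subset J^{\mathsf c},\ I_+\cap I_-=\emptyset\\|I_+|+|I_-|=d-r}}A(\nu^*;I_+,I_-,t_0),\qquad c(\lambda,\nu;q)=\prod_{\substack{1\le j<k\le m\\ \nu^\top_k<\nu^\top_j,\ \lambda^\top_k=\lambda^\top_j}}\frac{1-q^{1+k-j}}{1-q^{k-j}},$$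 where $\nu^*_j=n-\nu^\top_{m-j+1}$, $\lambda^*_j=n+1-\lambda^\top_{m-j+1}$ ($1\le j\le m$), $J^{\mathsf c}=\{1\le j\le m:\nu^*_j=\lambda^*_j\}$, and $$A(\nu^*;I_+,I_-,t_0)=\prod_{\substack{j,k\in J^{\mathsf c}\\ \nu^*_j=\nu^*_k,\ \epsilon_j>\epsilon_k}}\frac{1-q^{1+k-j}}{1-q^{k-j}}\prod_{\substack{j\in I_-,k\in I_+\\ \nu^*_j=\nu^*_k+1}}\frac{1-q^{1+k-j}}{1-q^{k-j}}\prod_{j\in J^{\mathsf c}}t_0^{-\epsilon_j}\prod_{\substack{j,k\in J^{\mathsf c},\ j<k\\ \epsilon_j\ne\epsilon_k=0}}q^{-\epsilon_j}\prod_{\substack{j,k\in J^{\mathsf c},\ j<k\\ \nu^*_j=\nu^*_k,\ \epsilon_k-\epsilon_j=1}}q^{-1},$$ with $\epsilon_j=1$ if $j\in I_+$, $\epsilon_j=-1$ if $j\in I_-$, and $\epsilon_j=0$ if $j\in J^{\mathsf c}\setminus(I_+\cup I_-)$. *)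

(* Defs.v *)
From HB Require Import structures.
From mathcomp Require Import all_boot all_order all_algebra.

Set Implicit Arguments.
Unset Strict Implicit.
Unset Printing Implicit Defensive.

Import Order.TTheory GRing.Theory Num.Theory.
Local Open Scope ring_scope.

(* Partitions with n (possibly zero) parts. *)
Definition Lambda (n : nat) : pred (seq nat) :=
  fun la => (size la == n) && sorted geq la.

(* The i-th part, for i >= 1; parts beyond the length are 0, which yields the
   conventions la_(n+1) = 0 for la in Lambda n, and nu_n = 0 for nu in
   Lambda (n-1).  The value at i = 0 is never used. *)
Definition part (la : seq nat) (i : nat) : nat := nth 0%N la i.-1.

Definition weight (la : seq nat) : nat := sumn la.

(* The i-th part of the transpose, for i >= 1. *)
Definition tr_part (la : seq nat) (i : nat) : nat :=
  count (fun p => (i <= p)%N) la.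

(* The number of nonzero parts of the transpose of la. *)
Definition tr_length (la : seq nat) : nat := part la 1.

(* nu \preceq mu : mu_1 >= nu_1 >= mu_2 >= nu_2 >= ...; beyond the larger of the
   two lengths all parts vanish. *)
Definition interlace (nu mu : seq nat) : bool :=
  all (fun i => (part nu i <= part mu i)%N && (part mu i.+1 <= part nu i)%N)
      (iota 1 (maxn (size nu) (size mu))).

(* min {nu_(j-1), la_j} for j >= 1, where nu_0 = +oo. *)
Definition min_prev (nu la : seq nat) (j : nat) : nat :=
  if j == 1%N then part la 1 else minn (part nu j.-1) (part la j).

(* max {nu_j, la_(j+1)} for j >= 1. *)
Definition max_next (nu la : seq nat) (j : nat) : nat :=
  maxn (part nu j) (part la j.+1).

Definition qpoch (K : numFieldType) (x q : K) (m : nat) : K :=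
  \prod_(0 <= k < m) (1 - x * q ^+ k).

Definition qbinom (K : numFieldType) (q : K) (m k : nat) : K :=
  qpoch q q m / (qpoch q q k * qpoch q q (m - k)).

(* The sum runs over mu in Lambda n with nu \preceq mu \preceq la; bounding the
   parts of mu by la_1 loses nothing, since mu_i <= la_i <= la_1. *)
Definition Qpol (K : numFieldType) (n : nat) (x q : K) (nu la : seq nat) : K :=
  \sum_(u : n.-tuple 'I_(part la 1).+1 |
        let mu := map val u in
        [&& Lambda n mu, interlace nu mu & interlace mu la])
    let mu := map val u in
    x ^ (2 * (weight mu)%:Z - (weight nu)%:Z - (weight la)%:Z) *
    (\prod_(1 <= i < n)
       (qbinom q (part la i - part la i.+1) (part la i - part mu i) *
        qbinom q (part mu i - part mu i.+1) (part mu i - part nu i))) *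
    qbinom q (part la n) (part la n - part mu n).

(* (1 - q^(1+k-j)) / (1 - q^(k-j)), with a possibly negative exponent k - j. *)
Definition qratio (K : numFieldType) (q : K) (j k : nat) : K :=
  (1 - q ^ (1 + k%:Z - j%:Z)) / (1 - q ^ (k%:Z - j%:Z)).

Definition tbracket (K : numFieldType) (q t0 x : K) (r : nat) : K :=
  \prod_(1 <= l < r.+1)
    (x + x^-1 - t0 * q ^+ (l - 1) - t0^-1 * q ^- (l - 1)).

(* nu^*_j and la^*_j, for 1 <= j <= m; the subtractions are never truncated for
   nu in Lambda (n-1) and la in Lambda n. *)
Definition nu_star (n m : nat) (nu : seq nat) (j : nat) : nat :=
  n - tr_part nu (m - j + 1).
Definition la_star (n m : nat) (la : seq nat) (j : nat) : nat :=
  n + 1 - tr_part la (m - j + 1).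

(* From here on, the indices 1 <= j <= m are encoded by 'I_m: the ordinal j
   stands for the index j.+1.  Differences k - j and comparisons of indices are
   unaffected by this shift. *)

Definition Jc (n m : nat) (la nu : seq nat) : {set 'I_m} :=
  [set j : 'I_m | nu_star n m nu j.+1 == la_star n m la j.+1].

Definition eps (m : nat) (Ip Im : {set 'I_m}) (j : 'I_m) : int :=
  if j \in Ip then 1 else if j \in Im then -1 else 0.

Definition Acoef (K : numFieldType) (n m : nat) (q t0 : K) (la nu : seq nat)
    (Ip Im : {set 'I_m}) : K :=
  let J := Jc n m la nu in
  let ns := fun j : 'I_m => nu_star n m nu j.+1 in
  let e := eps Ip Im in
  (\prod_(j in J) \prod_(k in J | (ns j == ns k) && (e k < e j)) qratio q j k) *
  (\prod_(j in Im) \prod_(k in Ip | ns j == (ns k).+1) qratio q j k) *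
  (\prod_(j in J) t0 ^ (- e j)) *
  (\prod_(j in J) \prod_(k in J | [&& (j < k)%N, e j != e k & e k == 0])
     q ^ (- e j)) *
  (\prod_(j in J)
     \prod_(k in J | [&& (j < k)%N, ns j == ns k & e k - e j == 1]) q^-1).

Definition ccoef (K : numFieldType) (m : nat) (q : K) (la nu : seq nat) : K :=
  \prod_(j < m)
    \prod_(k < m | [&& (j < k)%N, (tr_part nu k.+1 < tr_part nu j.+1)%N
                     & tr_part la k.+1 == tr_part la j.+1])
      qratio q j k.

Definition dnum (m : nat) (la nu : seq nat) : nat :=
  #|[set i : 'I_m | tr_part la i.+1 == (tr_part nu i.+1 + 1)%N]|.

Definition Bcoef (K : numFieldType) (n : nat) (q t0 : K) (la nu : seq nat)
    (r : nat) : K :=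
  let m := tr_length la in
  let J := Jc n m la nu in
  ccoef m q la nu *
  \sum_(I : {set 'I_m} * {set 'I_m} |
        [&& I.1 \subset J, I.2 \subset J, [disjoint I.1 & I.2]
          & (#|I.1| + #|I.2| == dnum m la nu - r)%N])
    Acoef n q t0 la nu I.1 I.2.

(* The branching polynomial P_(la \ nu)(x; q, t0), for la in Lambda n and nu in
   Lambda (n-1) such that every la^T_i - nu^T_i is 0, 1 or 2. *)
Definition Ppol (K : numFieldType) (n : nat) (x q t0 : K) (la nu : seq nat) : K :=
  \sum_(0 <= r < (dnum (tr_length la) la nu).+1)
    Bcoef n q t0 la nu r * tbracket q t0 x r.

(* Main.v *)
Require Import Defs.
From HB Require Import structures.
From mathcomp Require Import all_boot all_order all_algebra.
From mathcomp Require Import zify ring.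
Import Order.TTheory GRing.Theory Num.Theory.
Local Open Scope ring_scope.

Set Implicit Arguments.
Unset Strict Implicit.
Unset Printing Implicit Defensive.

(** Write M_h = max(nu_h, la_(h+1)) and W_h = min(nu_(h-1), la_h).  The
    partitions mu interlacing between nu and la form the box of all mu with
    M_h <= mu_h <= W_h, and the hypotheses on nu and la say that the h-th side
    of this box has length W_h - M_h equal to 0 or 1 and that no two adjacent
    sides are both nontrivial (separated).  Both polynomials turn out to be
      (prod_h C_h) * (x + 1/x)^d,
    where C_h is the q-multinomial coefficient of the composition
    la_h - la_(h+1) = (M_h - la_(h+1)) + (W_h - M_h) + (la_h - W_h),
    and where d, the sum of the W_h - M_h, is the number of nontrivial sides.
    This expression does not involve t0, which gives both claims at once.

    For P: a column c of the Young diagram of la with height h has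
    M_h < c <= W_h exactly when la^T_c - nu^T_c = 1.  Hence the columns indexed
    by J^c have pairwise distinct and nonadjacent heights, and every factor of A
    comparing two equal or adjacent values of nu^* is an empty product.  What
    is left of A is a weight on words in the letters +, -, 0 recording, for each
    nonzero letter, the number of zeros to its right.  Reading a word from the
    left, the three choices of its first letter in front of z later zeros
    contribute
      t0^-1 q^-z + t0 q^z + (x + 1/x - t0 q^z - 1/(t0 q^z)) = x + 1/x
    times <x; t0>_z, so the sum over all words is (x + 1/x)^d
    (sum_sign_weight).  The prefactor c(la, nu; q) only couples columns of the
    same height; within a block of columns of height h the ratios telescope to
    C_h (ccoef_blocks).

    For Q: each nontrivial side of the box contributes x or 1/x, because the
    M_h + W_h add up to |nu| + |la|; so the powers of x alone would sum to
    (x + 1/x)^d.  It remains to see that the product of q-binomials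
    has the same value prod_h C_h at every mu of the box (Qcoef_sep).  The factor
    that involves mu_i and mu_(i+1) splits into one depending on mu_i and one
    depending on mu_(i+1) because one of the two is forced (qbinom_split); after
    regrouping by index, each group equals C_h since one of two neighbouring
    choices in a multinomial coefficient is trivial (qbinom_exchange). *)

(** * q-binomial coefficients and products of ratios *)

Lemma qpoch_neq0 (K : numFieldType) (q : K) m : 0 < q -> q < 1 -> qpoch q q m != 0.
Proof.
move=> q0 q1; rewrite /qpoch prodf_seq_neq0; apply/allP => k _ /=.
by rewrite -exprS subr_eq0 eq_sym lt_eqF // exprn_ilt1 // ltW.
Qed.

Lemma qpochS (K : numFieldType) (q : K) m :
  qpoch q q m.+1 = qpoch q q m * (1 - q ^+ m.+1).
Proof. by rewrite /qpoch big_nat_recr //= -exprS. Qed.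

Lemma qbinom0 (K : numFieldType) (q : K) m : 0 < q -> q < 1 -> qbinom q m 0 = 1.
Proof.
move=> q0 q1; rewrite /qbinom subn0 {2}/qpoch big_geq // mul1r divff //.
exact: qpoch_neq0.
Qed.

Lemma qbinom_diag (K : numFieldType) (q : K) m : 0 < q -> q < 1 -> qbinom q m m = 1.
Proof.
move=> q0 q1; rewrite /qbinom subnn {3}/qpoch big_geq // mulr1 divff //.
exact: qpoch_neq0.
Qed.

Lemma qbinom_sym (K : numFieldType) (q : K) m k :
  (k <= m)%N -> qbinom q m (m - k) = qbinom q m k.
Proof. by move=> km; rewrite /qbinom subKn // [X in _ / X]mulrC. Qed.

Lemma qratioE (K : numFieldType) (q : K) j k : (j <= k)%N ->
  qratio q j k = (1 - q ^+ (k - j).+1) / (1 - q ^+ (k - j)).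
Proof.
move=> jk; rewrite /qratio.
have -> : (1 + k%:Z - j%:Z = (k - j).+1%:Z)%R by lia.
by have -> : (k%:Z - j%:Z = (k - j)%:Z)%R by lia.
Qed.

Lemma prod_qratio (K : numFieldType) (q : K) j b c : 0 < q -> q < 1 ->
  (j < b)%N -> (b <= c)%N ->
  \prod_(b <= k < c) qratio q j k = (1 - q ^+ (c - j)) / (1 - q ^+ (b - j)).
Proof.
move=> q0 q1 jb bc.
have nz k : (j < k)%N -> 1 - q ^+ (k - j) != 0.
  move=> jk; rewrite subr_eq0 eq_sym lt_eqF // exprn_ilt1 ?ltW //; lia.
move: bc; rewrite leq_eqVlt => /predU1P [<-|bc].
  by rewrite big_geq // divff // nz.
rewrite (eq_big_nat _ _ (F2 := fun k => (1 - q ^+ (k.+1 - j)) / (1 - q ^+ (k - j)))).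
  by rewrite telescope_prodf // => k /andP [bk _]; apply: nz; lia.
by move=> k /andP [bk _]; rewrite qratioE ?subSn //; lia.
Qed.

(** The product over k telescopes, leaving for each j the quotient
    (1 - q^(c-j)) / (1 - q^(b-j)); these assemble into q-factorials. *)
Lemma prod_qratio_blocks (K : numFieldType) (q : K) a b c : 0 < q -> q < 1 ->
  (a <= b)%N -> (b <= c)%N ->
  \prod_(a <= j < b) \prod_(b <= k < c) qratio q j k = qbinom q (c - a) (b - a).
Proof.
move=> q0 q1 ab bc.
have nz k : 1 - q ^+ k.+1 != 0.
  by rewrite subr_eq0 eq_sym lt_eqF // exprn_ilt1 // ltW.
rewrite (eq_big_nat _ _
  (F2 := fun j => (1 - q ^+ (c - j)) / (1 - q ^+ (b - j)))); last first.
  by move=> j /andP [_ jb]; rewrite prod_qratio.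
have [m bE] : exists m, b = (m + a)%N by exists (b - a)%N; lia.
rewrite {b}bE addnK in ab bc * => {ab}.
elim: m a bc => [|m IH] a bc; first by rewrite big_geq // qbinom0.
rewrite big_ltn; last by lia.
have -> : (m.+1 + a = m + a.+1)%N by lia.
rewrite IH; last by lia.
rewrite /qbinom.
have -> : (c - a = (c - a.+1).+1)%N by lia.
have -> : (m + a.+1 - a = m.+1)%N by lia.
rewrite subSS !qpochS; field.
by rewrite !qpoch_neq0 //= nz.
Qed.

(** Up to the factor binom(b, d)_q, which is 1 because b <= 1, both sides are
    the q-multinomial coefficient of (a, b, e): the left one splits b into d and
    b - d, distributes these over the outer parts, then detaches them again. *)
Lemma qbinom_exchange (K : numFieldType) (q : K) a b d e : 0 < q -> q < 1 ->
  (b <= 1)%N -> (d <= b)%N ->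
  qbinom q (a + b + e) (b - d + e) * qbinom q (a + d) d * qbinom q (b - d + e) (b - d) =
  qbinom q (a + b + e) a * qbinom q (b + e) b.
Proof.
move=> q0 q1 b1 db.
have qp0 : qpoch q q 0 = 1 by rewrite /qpoch big_geq.
rewrite /qbinom.
have -> : (a + b + e - (b - d + e) = a + d)%N by lia.
have -> : (a + d - d = a)%N by lia.
have -> : (b - d + e - (b - d) = e)%N by lia.
have -> : (a + b + e - a = b + e)%N by lia.
have -> : (b + e - b = e)%N by lia.
have nz := qpoch_neq0 _ q0 q1.
have [->|d1] := posnP d.
  rewrite !subn0 !addn0 qp0; field.
  by rewrite !nz.
have -> : d = b by lia.
rewrite subnn qp0; field.
by rewrite !nz.
Qed.

(** * Partitions and their columns *)

Lemma geq_trans : transitive geq.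
Proof. by move=> y x z /= xy yz; apply: leq_trans yz xy. Qed.

Lemma part_mono la i j : sorted geq la -> (1 <= i <= j)%N -> (part la j <= part la i)%N.
Proof.
move=> srt /andP [i1 ij]; rewrite /part.
have [jl|lj] := ltnP j.-1 (size la); last by rewrite nth_default.
apply: (sorted_leq_nth geq_trans _ 0%N srt) => //; rewrite ?inE; try lia.
by move=> x; exact: leqnn.
Qed.

Lemma part_oversize la i : (size la < i)%N -> part la i = 0%N.
Proof. by move=> h; rewrite /part nth_default //; lia. Qed.

(** Transposition is a Galois connection; this is how all column heights below
    are computed. *)
Lemma leq_tr_part la h c : sorted geq la -> (0 < h)%N -> (0 < c)%N ->
  (h <= tr_part la c)%N = (c <= part la h)%N.
Proof.
rewrite /tr_part /part.
case: h => // h; elim: la h => [|p la IH] h; rewrite /= ?nth_nil => srt _ c0.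
  by lia.
have srt' := path_sorted srt.
have [cp|pc] := leqP c p.
  case: h => [|h]; first by rewrite /=; lia.
  by rewrite /= -(IH h srt') //; lia.
have all_lt : all (fun x => (x <= p)%N) la.
  move: srt; rewrite (path_sortedE geq_trans) => /andP [h1 _].
  exact: h1.
have -> : count (fun p0 => (c <= p0)%N) la = 0%N.
  apply/eqP; rewrite -leqn0 leqNgt -has_count; apply/hasPn => x xl.
  by move/allP: all_lt => /(_ x xl); lia.
rewrite ltn0; case: h => [|h] /=; first by lia.
have [hl|hl] := ltnP h (size la); last by rewrite nth_default //; lia.
by move/allP: all_lt => /(_ _ (mem_nth 0%N hl)) /=; lia.
Qed.

(** The box of interlacing partitions has sides of length 0 or 1, and of two
    adjacent sides at least one is trivial. *)
Record separated (n : nat) (la nu : seq nat) : Prop := Separated {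
  sep_la : la \in Lambda n;
  sep_nu : nu \in Lambda n.-1;
  sep_range : forall h, (1 <= h <= n)%N ->
    (max_next nu la h <= min_prev nu la h <= (max_next nu la h).+1)%N;
  sep_gap : forall h, (1 <= h < n)%N ->
    min_prev nu la h = max_next nu la h \/
    min_prev nu la h.+1 = max_next nu la h.+1
}.

Lemma min_prev1 nu la : min_prev nu la 1 = part la 1.
Proof. by []. Qed.

Lemma min_prevS nu la h : (0 < h)%N ->
  min_prev nu la h.+1 = minn (part nu h) (part la h.+1).
Proof. by case: h. Qed.

Lemma min_prev_le nu la h : (0 < h)%N -> (min_prev nu la h <= part la h)%N.
Proof. by case: h => [|[|h]] // _; rewrite min_prevS // geq_minr. Qed.

Lemma LambdaP n la : la \in Lambda n -> size la = n /\ sorted geq la.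
Proof. by case/andP => /eqP. Qed.

Lemma tr_part_block la h j : sorted geq la -> (0 < h)%N ->
  (part la h.+1 <= j < part la h)%N -> tr_part la j.+1 = h.
Proof.
move=> srt h0 /andP [lo hi]; apply/eqP; rewrite eqn_leq leqNgt.
by rewrite !leq_tr_part // hi -ltnNge ltnS lo.
Qed.

(** Along the columns of height h, the height in nu drops from h to h - 1 after
    column M_h and to h - 2 after column W_h.  The columns are counted from 0, so
    column j + 1 is past position M_h when M_h <= j. *)
Lemma tr_part_block_inner n la nu h j : separated n la nu -> (1 <= h <= n)%N ->
  (part la h.+1 <= j < part la h)%N ->
  (tr_part nu j.+1 + (max_next nu la h <= j) + (min_prev nu la h <= j) = h)%N.
Proof.
move=> [/LambdaP [sla la_s] /LambdaP [snu nu_s] rng _] hn /andP [lo hi].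
have rh := rng h hn; have h0 : (0 < h)%N by lia.
have eM : (h <= tr_part nu j.+1)%N = (j < max_next nu la h)%N.
  by rewrite leq_tr_part // /max_next leq_max [X in _ || X]ltnNge lo orbF.
have eT : (tr_part nu j.+1 < h.+1)%N.
  rewrite ltnNge leq_tr_part // -ltnNge.
  have [hn1|hn1] := ltnP h n; last by rewrite part_oversize //; lia.
  have /= := rng h.+1; rewrite /max_next min_prevS //; lia.
have eW : (h <= (tr_part nu j.+1).+1)%N = (j < min_prev nu la h)%N.
  case: h h0 hn hi {lo rh eM eT} => [|[|h]] // h0 hn hi.
  by rewrite ltnS leq_tr_part // min_prevS // leq_min hi andbT.
have eE : (h <= (tr_part nu j.+1).+2)%N.
  case: h h0 hn hi {lo rh eM eT eW} => [|[|[|h]]] // h0 hn hi.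
  rewrite !ltnS leq_tr_part //.
  have /= := rng h.+2; rewrite /max_next min_prevS //; lia.
lia.
Qed.

(** The columns of height h are those in positions la_(h+1) + 1, ..., la_h. *)
Lemma big_blocks (R : Type) (idx : R) (op : Monoid.com_law idx) n la (F : nat -> R) :
  la \in Lambda n ->
  \big[op/idx]_(0 <= j < part la 1) F j =
  \big[op/idx]_(1 <= h < n.+1) \big[op/idx]_(part la h.+1 <= j < part la h) F j.
Proof.
move=> /LambdaP [sla la_s].
have gen k : \big[op/idx]_(part la k.+1 <= j < part la 1) F j =
  \big[op/idx]_(1 <= h < k.+1) \big[op/idx]_(part la h.+1 <= j < part la h) F j.
  elim: k => [|k IH]; first by rewrite !big_geq.
  rewrite big_nat_recr //= -IH Monoid.mulmC -big_cat_nat //; apply: part_mono => //; lia.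
by rewrite -gen (@part_oversize la n.+1) ?sla.
Qed.

Lemma big_nat_restrict (R : Type) (idx : R) (op : Monoid.law idx) (a m b c : nat)
    (P : pred nat) (F : nat -> R) :
  (a <= b)%N -> (c <= m)%N ->
  (forall k, (a <= k < m)%N -> P k = (b <= k < c)%N) ->
  \big[op/idx]_(a <= k < m | P k) F k = \big[op/idx]_(b <= k < c) F k.
Proof.
move=> ab cm PE; rewrite [RHS](big_nat_widen _ c m) // [RHS](big_nat_widenl _ a) //.
rewrite big_nat_cond [RHS]big_nat_cond; apply: eq_bigl => k /=.
by case akm: (a <= k < m)%N; rewrite //= PE // andbC.
Qed.

Lemma dnum_blocks n la nu : separated n la nu ->
  dnum (tr_length la) la nu =
  (\sum_(1 <= h < n.+1) (min_prev nu la h - max_next nu la h))%N.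
Proof.
move=> S; rewrite /dnum cardsE -sum1_card /tr_length big_mkcond /=.
pose F j := if tr_part la j.+1 == (tr_part nu j.+1 + 1)%N then 1%N else 0%N.
rewrite -(big_mkord xpredT F) (big_blocks _ _ (sep_la S)).
apply: eq_big_nat => h hn.
have [sla la_s] := LambdaP (sep_la S).
have h0 : (0 < h)%N by lia.
have hn' : (1 <= h <= n)%N by lia.
have rh := sep_range S hn'; have hp := min_prev_le nu la h0.
have lM : (part la h.+1 <= max_next nu la h)%N by rewrite leq_maxr.
rewrite -[RHS]muln1 -sum_nat_const_nat /F -big_mkcond /=.
apply: big_nat_restrict => // j hj.
rewrite (tr_part_block la_s h0 hj).
have := tr_part_block_inner S hn' hj; lia.
Qed.

(** The q-multinomial coefficient of the block of columns of height h, cut at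
    M_h and at W_h. *)
Definition block_coef (K : numFieldType) (q : K) (la nu : seq nat) (h : nat) : K :=
  qbinom q (part la h - part la h.+1) (max_next nu la h - part la h.+1) *
  qbinom q (part la h - max_next nu la h) (min_prev nu la h - max_next nu la h).

(** Two columns contribute to c(la, nu; q) when they have the same height h in
    la and different heights in nu, hence when they are separated by the cut at
    M_h or by the cut at W_h of their block.  The pairs separated at M_h give
    the first q-binomial of block_coef, the pairs to the right of M_h separated
    at W_h the second. *)
Lemma ccoef_blocks (K : numFieldType) (q : K) n la nu : 0 < q -> q < 1 ->
  separated n la nu ->
  ccoef (tr_length la) q la nu =
  \prod_(1 <= h < n.+1) block_coef q la nu h.
Proof.
move=> q0 q1 S; rewrite /ccoef /tr_length.
have [sla la_s] := LambdaP (sep_la S).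
pose F j := \prod_(0 <= k < part la 1 | [&& (j < k)%N,
  (tr_part nu k.+1 < tr_part nu j.+1)%N & tr_part la k.+1 == tr_part la j.+1])
  qratio q j.+1 k.+1.
transitivity (\prod_(0 <= j < part la 1) F j).
  rewrite big_mkord; apply: eq_bigr => j _; rewrite /F big_mkord.
  apply: eq_bigr => k /andP [jk _].
  by rewrite !qratioE ?subSS // ltnW.
rewrite (big_blocks _ _ (sep_la S)); apply: eq_big_nat => h hn.
have h0 : (0 < h)%N by lia.
have hn' : (1 <= h <= n)%N by lia.
have rh := sep_range S hn'; have hp := min_prev_le nu la h0.
have lM : (part la h.+1 <= max_next nu la h)%N by rewrite leq_maxr.
have l1 : (part la h <= part la 1)%N by apply: part_mono => //; lia.
set M := max_next nu la h in rh lM *; set W := min_prev nu la h in rh hp *.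
(* The contributing partners of column j start at the first cut after j. *)
pose B j := if (j < M)%N then M else if (j < W)%N then W else part la h.
have jB j : (part la h.+1 <= j < part la h)%N -> (part la h.+1 <= B j)%N && (j < B j)%N.
  by rewrite /B; case: ifP; [lia|case: ifP; lia].
have FB j : (part la h.+1 <= j < part la h)%N ->
    F j = \prod_(B j <= k < part la h) qratio q j k.
  move=> hj; rewrite /F.
  have BE k : (0 <= k < part la 1)%N -> [&& (j < k)%N,
      (tr_part nu k.+1 < tr_part nu j.+1)%N & tr_part la k.+1 == tr_part la j.+1]
      = (B j <= k < part la h)%N.
    move=> km; have [jk|kj] := ltnP j k; last first.
      by have := jB j hj; rewrite /=; lia.
    have [kh|hk] := ltnP k (part la h); last first.
      have -> : tr_part la k.+1 == tr_part la j.+1 = false.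
        rewrite (tr_part_block la_s h0 hj) ltn_eqF //.
        by rewrite ltnNge leq_tr_part // -ltnNge.
      by rewrite /= !andbF.
    have hk : (part la h.+1 <= k < part la h)%N by lia.
    rewrite (tr_part_block la_s h0 hj) (tr_part_block la_s h0 hk) eqxx andbT /=.
    have := tr_part_block_inner S hn' hj; have := tr_part_block_inner S hn' hk.
    rewrite -/M -/W /B; case: ifP; [lia|case: ifP; lia].
  rewrite (big_nat_restrict _ _ _ _ BE) //.
  apply: eq_big_nat => k hk; rewrite !qratioE ?subSS //; have := jB j hj; lia.
rewrite (eq_big_nat _ _ FB) (@big_cat_nat _ _ _ M) //=; last by lia.
rewrite (@big_cat_nat _ _ _ W M) /=; [|by lia|by lia].
have -> : \prod_(part la h.+1 <= j < M) \prod_(B j <= k < part la h) qratio q j k =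
    \prod_(part la h.+1 <= j < M) \prod_(M <= k < part la h) qratio q j k.
  by apply: eq_big_nat => j /andP [_ jM]; rewrite /B jM.
have -> : \prod_(M <= j < W) \prod_(B j <= k < part la h) qratio q j k =
    \prod_(M <= j < W) \prod_(W <= k < part la h) qratio q j k.
  by apply: eq_big_nat => j /andP [Mj jW]; rewrite /B jW ltnNge Mj.
have -> : \prod_(W <= j < part la h) \prod_(B j <= k < part la h) qratio q j k = 1.
  rewrite big_nat_cond big1 // => j; rewrite andbT => /andP [Wj _].
  rewrite /B big_geq //; case: ifP => [|_]; first by lia.
  by rewrite ltnNge Wj.
by rewrite mulr1 !prod_qratio_blocks //; lia.
Qed.

(** * The sum over signed words *)

Lemma sum_subsets_setU1 (R : nmodType) (T : finType) (a : T) (J : {set T})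
    (F : {set T} -> R) :
  a \notin J ->
  \sum_(A : {set T} | A \subset a |: J) F A =
  \sum_(A : {set T} | A \subset J) (F A + F (a |: A)).
Proof.
move=> aJ; rewrite (bigID (fun A : {set T} => a \in A)) /= addrC big_split /=.
congr (_ + _).
  apply: eq_bigl => A; apply/andP/idP => [[/subsetP sA aA]|sA].
    apply/subsetP => x xA; have := sA x xA; rewrite in_setU1 => /predU1P [xa|//].
    by rewrite -xa xA in aA.
  split; first by rewrite (subset_trans sA) // subsetUr.
  by apply: contra aJ => aA; apply: (subsetP sA).
rewrite (reindex_onto (fun A => a |: A) (fun A => A :\ a)) /=; last first.
  by move=> A /andP [_ aA]; rewrite setD1K.
apply: eq_bigl => A; rewrite setU11 andbT.
apply/andP/idP => [[sA /eqP <-]|sA].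
  by rewrite -[J](setU1K aJ) setSD.
split; first by rewrite setUS.
by rewrite setU1K //; apply: contra aJ => aA; apply: (subsetP sA).
Qed.

Section Words.
Variables (K : numFieldType) (q t0 x : K) (m : nat).

(** What remains of A when no two indices of J have equal or adjacent values
    of nu^*. *)
Definition sign_weight (J Ip Im : {set 'I_m}) : K :=
  \prod_(j in J) t0 ^ (- eps Ip Im j) *
  \prod_(j in J) \prod_(k in J | [&& (j < k)%N, eps Ip Im j != eps Ip Im k
                                   & eps Ip Im k == 0]) q ^ (- eps Ip Im j).

(** An index smaller than all of J sees every zero of J to its right and is
    itself seen by no other index. *)
Lemma sign_weight_min (a : 'I_m) (J Ip Im Ip' Im' : {set 'I_m}) :
  a \notin J -> (forall j, j \in J -> (a < j)%N) ->
  {in J, eps Ip' Im' =1 eps Ip Im} ->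
  sign_weight (a |: J) Ip' Im' =
  t0 ^ (- eps Ip' Im' a) *
  (if eps Ip' Im' a == 0 then 1
   else (q ^ (- eps Ip' Im' a)) ^+ #|[set k in J | eps Ip Im k == 0]|) *
  sign_weight J Ip Im.
Proof.
move=> aJ amin ee; rewrite /sign_weight !big_setU1 //=.
have -> : \prod_(j in J) t0 ^ (- eps Ip' Im' j) = \prod_(j in J) t0 ^ (- eps Ip Im j).
  by apply: eq_bigr => j jJ; rewrite ee.
set z := (if _ then _ else _).
have -> : \prod_(k in a |: J | [&& (a < k)%N, eps Ip' Im' a != eps Ip' Im' k
       & eps Ip' Im' k == 0]) q ^ (- eps Ip' Im' a) = z.
  rewrite /z; case: (eqVneq (eps Ip' Im' a) 0) => [-> |e0].
    by rewrite big1 // => k _; rewrite oppr0 expr0z.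
  rewrite prodr_const; congr (_ ^+ _); apply: eq_card => k.
  rewrite unfold_in /= !inE; case: (eqVneq k a) => [->|ka] /=.
    by rewrite ltnn (negPf aJ).
  case kJ: (k \in J) => //=; rewrite amin // (ee k) //=.
  by case: (eqVneq (eps Ip Im k) 0) => [->|_]; rewrite ?andbF ?e0.
rewrite [X in _ * (_ * X) = _](_ : _ = \prod_(j in J) \prod_(k in J | [&& (j < k)%N,
   eps Ip Im j != eps Ip Im k & eps Ip Im k == 0]) q ^ (- eps Ip Im j)).
  by rewrite mulrACA.
apply: eq_bigr => j jJ; rewrite ee //; apply: eq_bigl => k.
rewrite in_setU1; case: (eqVneq k a) => [->|ka] /=.
  by rewrite (negPf aJ) ltnNge ltnW // amin.
by case kJ: (k \in J) => //=; rewrite ee.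
Qed.

Lemma card_eps0 (J A B : {set 'I_m}) : A \subset J -> B \subset J :\: A ->
  #|[set k in J | eps A B k == 0]| = (#|J| - (#|A| + #|B|))%N.
Proof.
move=> AJ BJ.
have -> : [set k in J | eps A B k == 0] = (J :\: A) :\: B.
  apply/setP => k; rewrite !inE /eps.
  by case: (k \in A); case: (k \in B); rewrite ?andbF ?andbT.
by rewrite cardsDS // cardsDS // subnDA.
Qed.

(** Induction on J by removing its least index a: the cases where a has sign 0,
    -1 and +1 add up to (x + 1/x) times the term of J without a. *)
Lemma sum_sign_weight (J : {set 'I_m}) : q != 0 -> t0 != 0 ->
  \sum_(A : {set 'I_m} | A \subset J) \sum_(B : {set 'I_m} | B \subset J :\: A)
     sign_weight J A B * tbracket q t0 x (#|J| - (#|A| + #|B|)) =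
  (x + x^-1) ^+ #|J|.
Proof.
move=> q0 t00; move jE: #|J| => p; elim: p J jE => [|p IH] J jE.
  move/eqP: jE; rewrite cards_eq0 => /eqP ->.
  rewrite (big_pred1 set0); last by move=> A; rewrite subset0.
  rewrite (big_pred1 set0); last by move=> A; rewrite set0D subset0.
  by rewrite /sign_weight !big_set0 /tbracket big_geq // !mulr1 expr0.
have [j0 j0J] : exists j, j \in J by apply/card_gt0P; rewrite jE.
case: (@arg_minnP _ j0 (mem J) val j0J) => a /= aJ amin.
move: jE; rewrite (cardsD1 a) aJ add1n => - [jE].
(* From here on, the index set is a |: J' with a below all of J'. *)
have [J' [aJ' JE' jE' min']] : exists J' : {set 'I_m},
    [/\ a \notin J', J = a |: J', #|J'| = p & forall j, j \in J' -> (a < j)%N].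
  exists (J :\ a); split => //; first by rewrite !inE eqxx.
    by rewrite setD1K.
  move=> j; rewrite !inE => /andP [ja jJ].
  by rewrite ltn_neqAle amin // andbT eq_sym.
rewrite {}JE' {J j0 j0J aJ amin jE} exprS -(IH J' jE').
rewrite sum_subsets_setU1 // mulr_sumr; apply: eq_bigr => A AJ.
have aA : a \notin A by apply: contra aJ' => aA; apply: (subsetP AJ).
have -> : (a |: J') :\: A = a |: (J' :\: A).
  apply/setP => k; rewrite !inE; case: (eqVneq k a) => [->|//].
  by rewrite aA.
have -> : (a |: J') :\: (a |: A) = J' :\: A.
  apply/setP => k; rewrite !inE; case: (eqVneq k a) => [->|//] /=.
  by rewrite (negPf aJ') andbF.
rewrite sum_subsets_setU1; last by rewrite !inE (negPf aJ') andbF.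
rewrite -big_split mulr_sumr; apply: eq_bigr => B BJ /=.
have aB : a \notin B.
  by apply: contra aJ' => aB; have := subsetP BJ a aB; rewrite !inE => /andP [].
have e1 : {in J', eps A B =1 eps A B} by [].
have e2 : {in J', eps A (a |: B) =1 eps A B}.
  move=> j jJ; rewrite /eps in_setU1; case: (eqVneq j a) => [ja|//].
  by rewrite -ja jJ in aJ'.
have e3 : {in J', eps (a |: A) B =1 eps A B}.
  move=> j jJ; rewrite /eps in_setU1; case: (eqVneq j a) => [ja|//].
  by rewrite -ja jJ in aJ'.
rewrite (sign_weight_min aJ' min' e1) (sign_weight_min aJ' min' e2).
rewrite (sign_weight_min aJ' min' e3) (card_eps0 AJ BJ) jE'.
have -> : eps A B a = 0 by rewrite /eps (negPf aA) (negPf aB).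
have -> : eps A (a |: B) a = -1 by rewrite /eps (negPf aA) setU11.
have -> : eps (a |: A) B a = 1 by rewrite /eps setU11.
rewrite !cardsU1 aA aB.
have le : (#|A| + #|B| <= p)%N.
  rewrite -jE' -(cardsID A J') (setIidPr AJ) leq_add2l; exact: subset_leq_card.
have -> : (p.+1 - (#|A| + #|B|) = (p - (#|A| + #|B|)).+1)%N by lia.
have -> : (p.+1 - (#|A| + (true + #|B|)) = p - (#|A| + #|B|))%N by lia.
have -> : (p.+1 - (true + #|A| + #|B|) = p - (#|A| + #|B|))%N by lia.
move: (p - _)%N => z.
rewrite eqxx /= oppr0 expr0z opprK !expr1z.
have -> : (t0 ^ (- 1) = t0^-1) by rewrite -exprN1.
have -> : (q ^ (- 1) = q^-1) by rewrite -exprN1.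
have -> : tbracket q t0 x z.+1 = tbracket q t0 x z *
   (x + x^-1 - t0 * q ^+ z - t0^-1 * q ^- z).
  by rewrite /tbracket big_nat_recr //= subn1.
by rewrite exprVn; ring.
Qed.
End Words.

(** * The branching polynomial *)

Lemma unit_jump_column n la nu i : separated n la nu ->
  tr_part la i.+1 = (tr_part nu i.+1 + 1)%N ->
  let h := tr_part la i.+1 in
  (1 <= h <= n)%N /\ (max_next nu la h <= i < min_prev nu la h)%N.
Proof.
move=> S jmp h.
have [sla la_s] := LambdaP (sep_la S).
have h0 : (0 < h)%N by rewrite /h jmp; lia.
have hn : (1 <= h <= n)%N by rewrite h0 /h -sla; apply: count_size.
split=> //.
have hi : (part la h.+1 <= i < part la h)%N.
  have := leq_tr_part la_s (ltn0Sn h) (ltn0Sn i).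
  have := leq_tr_part la_s h0 (ltn0Sn i).
  rewrite -/h; lia.
have := sep_range S hn; have := tr_part_block_inner S hn hi; rewrite -/h in jmp; lia.
Qed.

(** J^c lists the columns in reverse order, hence rev_ord. *)
Lemma in_Jc n la nu (j : 'I_(tr_length la)) : separated n la nu ->
  (j \in Jc n (tr_length la) la nu) =
  (tr_part la (rev_ord j).+1 == (tr_part nu (rev_ord j).+1 + 1)%N).
Proof.
move=> S; rewrite inE /nu_star /la_star /=.
have [sla la_s] := LambdaP (sep_la S); have [snu _] := LambdaP (sep_nu S).
have jm := ltn_ord j.
have -> : (tr_length la - j.+1 + 1 = (tr_length la - j.+1).+1)%N by lia.
set c := (_ - _).+1.
have la_n : (tr_part la c <= n)%N by rewrite -[X in (_ <= X)%N]sla count_size.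
have nu_n : (tr_part nu c <= n.-1)%N by rewrite -[X in (_ <= X)%N]snu count_size.
have [n0|n0] := posnP n; last by lia.
have m0 : (0 < part la 1)%N by exact: leq_ltn_trans (leq0n j) jm.
by rewrite part_oversize ?sla ?n0 in m0.
Qed.

Lemma card_Jc n la nu : separated n la nu ->
  #|Jc n (tr_length la) la nu| = dnum (tr_length la) la nu.
Proof.
move=> S; rewrite /dnum -(card_imset _ (@rev_ord_inj (tr_length la))).
apply: eq_card => i; rewrite in_Jc // -[in RHS](rev_ordK i).
by rewrite mem_imset ?inE //; exact: rev_ord_inj.
Qed.

(** Two columns of J^c of equal height would need a side of length 2, two of
    adjacent heights would need two adjacent nontrivial sides. *)
Lemma nu_star_spread n la nu (j k : 'I_(tr_length la)) :
  let m := tr_length la in separated n la nu ->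
  j \in Jc n m la nu -> k \in Jc n m la nu ->
  (nu_star n m nu j.+1 == nu_star n m nu k.+1) = (j == k) /\
  nu_star n m nu j.+1 != (nu_star n m nu k.+1).+1.
Proof.
move=> m S; rewrite !in_Jc // => /eqP jj /eqP kk.
have [] := unit_jump_column S jj.
have [] := unit_jump_column S kk.
move: jj kk; rewrite /nu_star /=.
have := ltn_ord j; have := ltn_ord k; rewrite -/m => km jm.
have -> : (m - j.+1 + 1 = (m - j.+1).+1)%N by lia.
have -> : (m - k.+1 + 1 = (m - k.+1).+1)%N by lia.
rewrite -/m; set hj := tr_part la (m - j.+1).+1; set hk := tr_part la (m - k.+1).+1.
move=> jj kk rk ik rj ij; split.
  apply/eqP/eqP => [e|->//]; apply: ord_inj.
  have hh : hj = hk by lia.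
  have := sep_range S rj; rewrite hh in ij *; lia.
apply/negP => /eqP e.
have hh : hk = hj.+1 by lia.
have [] := @sep_gap _ _ _ S hj; rewrite -?hh; lia.
Qed.

Lemma Acoef_sep (K : numFieldType) (q t0 : K) n la nu
    (Ip Im : {set 'I_(tr_length la)}) :
  let J := Jc n (tr_length la) la nu in
  separated n la nu -> Ip \subset J -> Im \subset J ->
  Acoef n q t0 la nu Ip Im = sign_weight q t0 J Ip Im.
Proof.
move=> J S IpJ ImJ; rewrite /Acoef -/J.
have sp := nu_star_spread S.
rewrite [X in X * _ * _ * _ * _](_ : _ = 1); last first.
  rewrite big1 // => j jJ; rewrite big1 // => k /and3P [kJ].
  by rewrite (sp _ _ jJ kJ).1 => /eqP ->; rewrite ltxx.
rewrite [X in _ * X * _ * _ * _](_ : _ = 1); last first.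
  rewrite big1 // => j jI; rewrite big1 // => k /andP [kI].
  by rewrite (negPf (sp _ _ (subsetP ImJ _ jI) (subsetP IpJ _ kI)).2).
rewrite [X in _ * X = _](_ : _ = 1); last first.
  rewrite big1 // => j jJ; rewrite big1 // => k /and4P [kJ jk].
  by rewrite (sp _ _ jJ kJ).1 => /eqP jk'; rewrite jk' ltnn in jk.
by rewrite !mul1r mulr1.
Qed.

(** Used to replace the sum over r of the sums over |I_+| + |I_-| = d - r by a
    single sum over all disjoint pairs. *)
Lemma sum_by_value (R : nmodType) (I : finType) (P : pred I) (h : I -> nat)
    (d : nat) (G : nat -> I -> R) :
  (forall i, P i -> (h i <= d)%N) ->
  \sum_(0 <= r < d.+1) \sum_(i | P i && (h i == d - r)%N) G r i =
  \sum_(i | P i) G (d - h i)%N i.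
Proof.
move=> hP; rewrite big_mkord (exchange_big_dep P) /=; last by move=> r i _ /andP [].
apply: eq_bigr => i Pi; have hi := hP i Pi.
rewrite (big_pred1 (inord (d - h i)%N)) => [|r] /=; first by rewrite inordK //; lia.
rewrite Pi -val_eqE /= inordK; last by lia.
have := ltn_ord r; lia.
Qed.

Lemma Ppol_sep (K : numFieldType) (q t0 x : K) n la nu :
  q != 0 -> t0 != 0 -> separated n la nu ->
  Ppol n x q t0 la nu =
  ccoef (tr_length la) q la nu * (x + x^-1) ^+ dnum (tr_length la) la nu.
Proof.
move=> q0 t00 S; rewrite /Ppol /Bcoef.
set m := tr_length la; set J := Jc n m la nu; set d := dnum m la nu.
have Jd : #|J| = d by exact: card_Jc.
pose P (I : {set 'I_m} * {set 'I_m}) :=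
  [&& I.1 \subset J, I.2 \subset J & [disjoint I.1 & I.2]].
pose h (I : {set 'I_m} * {set 'I_m}) := (#|I.1| + #|I.2|)%N.
have PE I : P I = (I.1 \subset J) && (I.2 \subset J :\: I.1).
  by rewrite /P subsetD disjoint_sym.
have hP I : P I -> (h I <= d)%N.
  rewrite PE => /andP [AJ BJ]; rewrite /h -Jd -(cardsID I.1 J) (setIidPr AJ).
  by rewrite leq_add2l; exact: subset_leq_card.
pose G r I := sign_weight q t0 J I.1 I.2 * tbracket q t0 x r.
rewrite -Jd -(sum_sign_weight x J q0 t00) pair_big_dep /= Jd.
rewrite -(eq_bigl _ _ PE) -(@sum_by_value _ _ P h d G hP) // mulr_sumr.
apply: eq_bigr => r _; rewrite -mulrA; congr (_ * _).
rewrite mulr_suml; apply: eq_big => [I|I /and4P [h1 h2 _ _]].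
  by rewrite /P -!andbA.
by rewrite /G Acoef_sep.
Qed.

(** * The polynomial Q *)

Lemma interlaceP n nu mu : maxn (size nu) (size mu) = n ->
  reflect (forall h, (1 <= h <= n)%N -> (part mu h.+1 <= part nu h <= part mu h)%N)
    (interlace nu mu).
Proof.
move=> sz; rewrite /interlace sz; apply: (iffP allP) => H h.
  by move=> hn; have := H h; rewrite mem_iota; lia.
by rewrite mem_iota => hn; have := H h; lia.
Qed.

Lemma interlace_box n la nu mu : (0 < n)%N -> separated n la nu -> size mu = n ->
  [&& Lambda n mu, interlace nu mu & interlace mu la] =
  [forall i : 'I_n, (max_next nu la i.+1 <= part mu i.+1 <= min_prev nu la i.+1)%N].
Proof.
move=> n0 S smu.
have [sla la_s] := LambdaP (sep_la S); have [snu nu_s] := LambdaP (sep_nu S).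
have sz1 : maxn (size nu) (size mu) = n by lia.
have sz2 : maxn (size mu) (size la) = n by lia.
apply/and3P/forallP => [[_ /(interlaceP sz1) nm /(interlaceP sz2) ml] i|box].
  have i1 : (1 <= i.+1 <= n)%N by rewrite /= ltn_ord.
  have := nm _ i1; have := ml _ i1; rewrite /max_next => h1 h2.
  apply/andP; split; first by lia.
  case: (posnP i) h1 => [->|i0] h1; first by rewrite min_prev1; lia.
  rewrite min_prevS //; have := nm i; lia.
have bx h : (1 <= h <= n)%N ->
    (max_next nu la h <= part mu h <= min_prev nu la h)%N.
  by case: h => // h hn; apply: (box (Ordinal hn)).
have mun i : (n < i)%N -> part mu i = 0%N by move=> hi; rewrite part_oversize // smu.
have mu_nu h : (1 <= h <= n)%N -> (part mu h.+1 <= part nu h <= part mu h)%N.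
  move=> hn; have := bx h hn; rewrite /max_next.
  have [hlt|] := ltnP h n; last by move=> ?; rewrite (mun h.+1) //; lia.
  have := bx h.+1; rewrite min_prevS; lia.
split.
- rewrite /Lambda smu eqxx /=; apply/(sortedP 0%N) => i; rewrite smu => i_n /=.
  have := mu_nu i.+1; rewrite /part /=; lia.
- exact/(interlaceP sz1).
- apply/(interlaceP sz2) => h hn; have := bx h hn; rewrite /max_next.
  have := @min_prev_le nu la h; lia.
Qed.

(** One of mu_i = M_i and mu_(i+1) = W_(i+1) holds because adjacent sides are
    not both nontrivial; moreover one of nu_i, la_(i+1) is M_i and the other is
    W_(i+1).  In each of the four cases two of the three q-binomials agree and
    the remaining one is 1. *)
Lemma qbinom_split (K : numFieldType) (q : K) (n : nat) la nu mu i :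
  0 < q -> q < 1 -> separated n la nu -> (1 <= i < n)%N ->
  (forall h, (1 <= h <= n)%N -> (max_next nu la h <= part mu h <= min_prev nu la h)%N) ->
  qbinom q (part mu i - part mu i.+1) (part mu i - part nu i) =
  qbinom q (part mu i - part la i.+1) (part mu i - max_next nu la i) *
  qbinom q (part la i.+1 - part mu i.+1) (min_prev nu la i.+1 - part mu i.+1).
Proof.
move=> q0 q1 S i_n bx.
have i1 : (1 <= i <= n)%N by lia.
have i2 : (1 <= i.+1 <= n)%N by lia.
have := bx _ i1; have := bx _ i2; have := sep_range S i1; have := sep_range S i2.
have gap := sep_gap S i_n.
have -> : max_next nu la i = maxn (part nu i) (part la i.+1) by [].
have Wi : min_prev nu la i.+1 = minn (part nu i) (part la i.+1).
  by rewrite min_prevS //; lia.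
rewrite Wi => r2 r1 b2 b1.
have [le|lt] := leqP (part la i.+1) (part nu i).
  rewrite qbinom_diag // mulr1.
  case: gap => gap.
    have -> : (part mu i - part nu i = 0)%N by rewrite /max_next in gap; lia.
    by rewrite !qbinom0.
  by have -> : part mu i.+1 = part la i.+1 by lia.
rewrite qbinom_diag // mul1r.
case: gap => gap.
  have -> : part mu i = part la i.+1 by rewrite /max_next in gap; lia.
  rewrite -qbinom_sym; last by lia.
  by congr qbinom; lia.
have -> : part mu i.+1 = part nu i by lia.
by rewrite subnn qbinom0 // qbinom_diag.
Qed.

Lemma prod_regroup (R : comPzRingType) (n : nat) (f u v : nat -> R) :
  (0 < n)%N -> u n = 1 -> v 1%N = 1 ->
  (\prod_(1 <= i < n) (f i * (u i * v i.+1))) * f n =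
  \prod_(1 <= h < n.+1) (f h * u h * v h).
Proof.
move=> n0 un v1; rewrite !big_split /=.
rewrite [X in _ = X * _ * _]big_nat_recr //= [X in _ = _ * X * _]big_nat_recr //=.
rewrite [X in _ = _ * _ * X]big_ltn //= [X in _ = _ * _ * (_ * X)]big_add1 /= un v1.
ring.
Qed.

(** After regrouping the split factors by index, the two unmatched end factors
    are 1 because W_1 = la_1 and M_n = la_(n+1) = 0. *)
Lemma Qcoef_sep (K : numFieldType) (q : K) (n : nat) la nu mu :
  0 < q -> q < 1 -> separated n la nu -> (0 < n)%N ->
  (forall h, (1 <= h <= n)%N -> (max_next nu la h <= part mu h <= min_prev nu la h)%N) ->
  (\prod_(1 <= i < n)
       (qbinom q (part la i - part la i.+1) (part la i - part mu i) *
        qbinom q (part mu i - part mu i.+1) (part mu i - part nu i))) *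
    qbinom q (part la n) (part la n - part mu n) =
  \prod_(1 <= h < n.+1) block_coef q la nu h.
Proof.
move=> q0 q1 S n0 bx.
have [sla la_s] := LambdaP (sep_la S); have [snu nu_s] := LambdaP (sep_nu S).
pose f i := qbinom q (part la i - part la i.+1) (part la i - part mu i).
pose u i := qbinom q (part mu i - part la i.+1) (part mu i - max_next nu la i).
pose v i := qbinom q (part la i - part mu i) (min_prev nu la i - part mu i).
have la0 : part la n.+1 = 0%N by rewrite part_oversize // sla.
have un : u n = 1.
  have Mn : max_next nu la n = 0%N.
    by rewrite /max_next la0 part_oversize // snu; lia.
  by rewrite /u la0 Mn qbinom_diag.
have v1 : v 1%N = 1 by rewrite /v min_prev1 qbinom_diag.
transitivity (\prod_(1 <= h < n.+1) (f h * u h * v h)).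
  rewrite (eq_big_nat _ _ (F2 := fun i => f i * (u i * v i.+1))); last first.
    by move=> i i_n; rewrite (qbinom_split q0 q1 S i_n bx).
  have fn : f n = qbinom q (part la n) (part la n - part mu n).
    by rewrite /f la0 subn0.
  by rewrite -fn (prod_regroup f n0 un v1).
apply: eq_big_nat => h hn.
have h1 : (1 <= h <= n)%N by lia.
have h0 : (0 < h)%N by lia.
have := bx h h1; have := sep_range S h1; have := @min_prev_le nu la h h0.
have : (part la h.+1 <= max_next nu la h)%N by rewrite leq_maxr.
rewrite /block_coef /f /u /v.
move: (max_next _ _ _) (min_prev _ _ _) (part _ h.+1) (part la h) (part mu h)
  => M W L' L m LM WL MW Mm.
have := @qbinom_exchange K q (M - L') (W - M) (m - M) (L - W) q0 q1.
have -> : (M - L' + (W - M) + (L - W) = L - L')%N by lia.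
have -> : (W - M - (m - M) + (L - W) = L - m)%N by lia.
have -> : (M - L' + (m - M) = m - L')%N by lia.
have -> : (W - M - (m - M) = W - m)%N by lia.
have -> : (W - M + (L - W) = L - M)%N by lia.
by apply; lia.
Qed.

Lemma weightE n la : size la = n -> weight la = (\sum_(1 <= h < n.+1) part la h)%N.
Proof. by move=> <-; rewrite /weight sumnE (big_nth 0%N) big_add1. Qed.

(** Each pair M_h, W_(h+1) is the pair nu_h, la_(h+1) sorted. *)
Lemma sum_box_ends n la nu : separated n la nu -> (0 < n)%N ->
  (\sum_(1 <= h < n.+1) (max_next nu la h + min_prev nu la h) =
   weight nu + weight la)%N.
Proof.
move=> S n0.
have [sla la_s] := LambdaP (sep_la S); have [snu nu_s] := LambdaP (sep_nu S).
rewrite (weightE snu) (weightE sla) (prednK n0) big_split /=.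
rewrite big_nat_recr //= [X in (_ + X)%N = _]big_ltn //=.
rewrite [X in (_ + (_ + X))%N = _]big_add1 /=.
rewrite [X in _ = (_ + X)%N]big_ltn //= [X in _ = (_ + (_ + X))%N]big_add1 /=.
have -> : max_next nu la n = 0%N.
  by rewrite /max_next !part_oversize ?sla ?snu //; lia.
rewrite addn0 addnCA [RHS]addnCA min_prev1; congr (_ + _)%N.
rewrite -!big_split /=; apply: eq_big_nat => h hn /=.
by rewrite /max_next min_prevS ?addn_max_min //; lia.
Qed.

Lemma sum_unit_interval (K : numFieldType) (x : K) (N M W : nat) :
  x != 0 -> (M <= W <= M.+1)%N -> (W <= N)%N ->
  \sum_(k < N.+1 | (M <= k <= W)%N) x ^ (2 * k%:Z - M%:Z - W%:Z) =
  (x + x^-1) ^+ (W - M).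
Proof.
move=> x0 MW WN.
rewrite -(big_mkord (fun k => (M <= k <= W)%N) (fun k => x ^ (2 * k%:Z - M%:Z - W%:Z))).
rewrite (@big_nat_restrict _ _ _ 0%N N.+1 M W.+1) //.
have [->|->] : W = M \/ W = M.+1 by lia.
  rewrite big_nat1 subnn.
  by have -> : (2 * M%:Z - M%:Z - M%:Z = 0) by ring.
rewrite big_ltn // big_nat1 subSnn [RHS]expr1 [RHS]addrC.
have -> : (2 * M%:Z - M%:Z - M.+1%:Z = -1) by lia.
have -> : (2 * M.+1%:Z - M%:Z - M.+1%:Z = 1) by lia.
by rewrite expr1z exprN1.
Qed.

Lemma sum_tuples (R : comNzSemiRingType) (T : finType) (n : nat)
    (P : 'I_n -> pred T) (F : 'I_n -> T -> R) :
  \sum_(u : n.-tuple T | [forall i, P i (tnth u i)]) \prod_(i < n) F i (tnth u i) =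
  \prod_(i < n) \sum_(k | P i k) F i k.
Proof.
rewrite bigA_distr_big_dep /=.
rewrite (reindex (fun f : {ffun 'I_n -> T} => [tuple f i | i < n])) /=; last first.
  exists (fun u : n.-tuple T => [ffun i => tnth u i]) => [f _|u _].
    by apply/ffunP => i; rewrite ffunE tnth_mktuple.
  by apply: eq_from_tnth => i; rewrite tnth_mktuple ffunE.
apply: eq_big => [f|f _]; last by apply: eq_bigr => i _; rewrite tnth_mktuple.
by apply/forallP/familyP => H i; have := H i; rewrite ?tnth_mktuple.
Qed.

Lemma prodr_expz (K : fieldType) (x : K) (I : Type) (r : seq I) (F : I -> int) :
  x != 0 -> \prod_(i <- r) x ^ F i = x ^ (\sum_(i <- r) F i).
Proof.
move=> x0; elim: r => [|i r IH]; first by rewrite !big_nil expr0z.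
by rewrite !big_cons IH expfzDr.
Qed.

Lemma Qpol_sep (K : numFieldType) (q x : K) n la nu :
  0 < q -> q < 1 -> x != 0 -> (0 < n)%N -> separated n la nu ->
  Qpol n x q nu la =
  (\prod_(1 <= h < n.+1) block_coef q la nu h) *
  (x + x^-1) ^+ (\sum_(1 <= h < n.+1) (min_prev nu la h - max_next nu la h)).
Proof.
move=> q0 q1 x0 n0 S; rewrite /Qpol.
have [sla la_s] := LambdaP (sep_la S).
have su (u : n.-tuple 'I_(part la 1).+1) : size (map val u) = n.
  by rewrite size_map size_tuple.
have pu (u : n.-tuple 'I_(part la 1).+1) (i : 'I_n) :
    part (map val u) i.+1 = tnth u i.
  by rewrite /part /= (nth_map ord0) ?size_tuple // -tnth_nth.
pose P (i : 'I_n) (k : 'I_(part la 1).+1) :=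
  (max_next nu la i.+1 <= k <= min_prev nu la i.+1)%N.
pose F (i : 'I_n) (k : 'I_(part la 1).+1) : K :=
  x ^ (2 * (k : nat)%:Z - (max_next nu la i.+1)%:Z - (min_prev nu la i.+1)%:Z).
set c := (X in _ = X * _).
transitivity (c * \sum_(u : n.-tuple 'I_(part la 1).+1 | [forall i, P i (tnth u i)])
    \prod_(i < n) F i (tnth u i)); last first.
  congr (_ * _); rewrite sum_tuples big_add1 /= big_mkord -prodrXr.
  apply: eq_bigr => i _; rewrite /F /P sum_unit_interval //.
    by apply: (sep_range S); rewrite /= ltn_ord.
  by apply: (leq_trans (min_prev_le _ _ _)) => //; apply: part_mono.
rewrite mulr_sumr; apply: eq_big => [u|u].
  rewrite (interlace_box n0 S (su u)); apply: eq_forallb => i.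
  by rewrite pu.
rewrite (interlace_box n0 S (su u)) => /forallP box.
rewrite -mulrA (@Qcoef_sep _ q n la nu (map val u)) //; last first.
  by case=> // h hn; apply: (box (Ordinal hn)).
rewrite mulrC -/c; congr (_ * _).
rewrite prodr_expz //; congr (_ ^ _).
rewrite -addrA -opprD -PoszD -(sum_box_ends S n0) (weightE (su u)).
rewrite big_add1 big_mkord [in X in _ - X]big_add1 [in X in _ - X]big_mkord /=.
rewrite !(big_morph Posz PoszD (erefl _)).
rewrite mulr_sumr -sumrB; apply: eq_bigr => i _.
by rewrite pu PoszD; ring.
Qed.

(** * The comparison of P and Q *)

Lemma gapped_not_adjacent (s : seq nat) h : sorted ltn s ->
  (forall i, (i.+1 < size s)%N -> (nth 0%N s i + 1 < nth 0%N s i.+1)%N) ->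
  h \in s -> h.+1 \in s -> False.
Proof.
move=> s_lt gap hs Shs.
have s_le : sorted leq s by apply: sub_sorted s_lt => a b; exact: ltnW.
have nth_le i j : (j < size s)%N -> (i <= j)%N -> (nth 0%N s i <= nth 0%N s j)%N.
  move=> js ij; apply: (sorted_leq_nth leq_trans leqnn 0%N s_le) => //.
  by rewrite inE (leq_ltn_trans ij).
have i_s := hs; have j_s := Shs; rewrite -index_mem in i_s; rewrite -index_mem in j_s.
have [ij|ji] := ltnP (index h s) (index h.+1 s).
  have := nth_le _ _ j_s ij; have := gap _ (leq_ltn_trans ij j_s).
  rewrite !nth_index //; lia.
by have := nth_le _ _ i_s ji; rewrite !nth_index // ltnn.
Qed.

Theorem proposition2p5p5 (K : numFieldType) (q : K) (n : nat)
  (la nu : seq nat) (d : nat) (s : seq nat)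
  (hq0 : 0 < q) (hq1 : q < 1)
  (hn : (1 <= n)%N) (hla : la \in Lambda n) (hnu : nu \in Lambda n.-1)
  (hd : (1 <= d <= tr_length la)%N)
  (hsd : size s = d)
  (hsrange : forall j, j \in s -> (1 <= j <= n)%N)
  (hsincr : sorted ltn s)
  (hsgap : forall i, (i.+1 < d)%N -> (nth 0 s i + 1 < nth 0 s i.+1)%N)
  (hone : forall j, j \in s -> min_prev nu la j = (max_next nu la j + 1)%N)
  (hzero : forall j, (1 <= j <= n)%N -> j \notin s ->
     max_next nu la j = min_prev nu la j) :
  (forall t0 t0' : K, 0 < `|t0| < 1 -> 0 < `|t0'| < 1 ->
     forall x : K, x != 0 -> Ppol n x q t0 la nu = Ppol n x q t0' la nu) /\
  (forall t0 : K, 0 < `|t0| < 1 ->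
     forall x : K, x != 0 -> Qpol n x q nu la = Ppol n x q t0 la nu).
Proof.
have S : separated n la nu.
  split=> // h h_n.
    case: (boolP (h \in s)) => hs; first by rewrite (hone _ hs); lia.
    by rewrite (hzero _ h_n hs); lia.
  case: (boolP (h \in s)) => hs; last by left; rewrite hzero //; lia.
  case: (boolP (h.+1 \in s)) => Shs; last by right; rewrite hzero //; lia.
  by case: (gapped_not_adjacent hsincr _ hs Shs); rewrite hsd.
have PE t0 x : 0 < `|t0| < 1 -> Ppol n x q t0 la nu =
    ccoef (tr_length la) q la nu * (x + x^-1) ^+ dnum (tr_length la) la nu.
  by rewrite normr_gt0 => /andP [t00 _]; apply: Ppol_sep => //; rewrite gt_eqF.
split=> [t0 t0' ht ht' x _|t0 ht x x0]; first by rewrite !PE.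
by rewrite PE // Qpol_sep // (ccoef_blocks hq0 hq1 S) (dnum_blocks S).
Qed.
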